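(* Let $\mathcal{A}=\{A_1,\dots,A_m\}$ be a finite set of real $n\times n$ matrices. For a scalar $\gamma>0$, let $\mathcal{A}_\gamma:=\{\gamma A_1,\dots,\gamma A_m\}$. Let $G(N,E)$ be a path-complete graph whose edges are labeled with words from $\mathcal{A}_\gamma^*$. If there exist positive, continuous, and homogeneous functions $V_i:\mathbb{R}^n\to\mathbb{R}$, one per node of the graph, such that $\{V_i : i=1,\dots,|N|\}$ is a graph Lyapunov function associated with $G(N,E)$, then $\rho(\mathcal{A})\le\frac1\gamma$.
   Context: The joint spectral radius of a finite set $\mathcal{A}=\{A_1,\dots,A_m\}$ of square matrices is $\rho(\mathcal{A})=\lim_{k\to\infty}\max_{\sigma\in\{1,\dots,m\}^k}\|A_{\sigma_k}\cdots A_{\sigma_2}A_{\sigma_1}\|^{1/k}$ (independent of the norm). Words. The set of matrices is regarded as a finite alphabet; a word is a finite product of letters, read from right to left. For an alphabet $\mathcal{B}$, $\mathcal{B}^k$ is the set of words of length $k$ and $\mathcal{B}^*=\bigcup_{k\ge1}\mathcal{B}^k$. Expanded graph. $G(N,E)$ is a finite directed graph (parallel edges and self-loops allowed) whose edges are labeled by words from $\mathcal{B}^*$. Its expanded graph $G^e(N^e,E^e)$ is obtained by replacing every edge from $i$ to $j$ with label $B_{k}\cdots B_{1}$, $k>1$, by a directed path of $k$ new edges $i\to s_1\to\cdots\to s_{k-1}\to j$ through $k-1$ newly added nodes, labeled in this order $B_{1},\dots,B_{k}$; edges with labels of length one are kept. Path-completeness. $G$ is path-complete (for the alphabet $\mathcal{B}=\{B_1,\dots,B_m\}$)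 if for every word $B_{\sigma_k}\cdots B_{\sigma_1}$ of any length $k\ge1$ there is a directed path in $G^e$ whose consecutive edge labels are $B_{\sigma_1},\dots,B_{\sigma_k}$. Here the alphabet is $\mathcal{B}=\mathcal{A}_\gamma$. Graph Lyapunov function. A family $\{V_i: i=1,\dots,|N|\}$ of functions, one per node, is a graph Lyapunov function associated with $G(N,E)$ if $V_j(L((i,j))\,x)\le V_i(x)$ for all $x\in\mathbb{R}^n$ and all edges $(i,j)\in E$ going from node $i$ to node $j$, where $L((i,j))$ is the matrix product given by the label of the edge. Positive means $V_i(x)>0$ for all $x\ne0$; homogeneous means $V_i(\lambda x)=\lambda^{d}V_i(x)$ for all $\lambda\in\mathbb{R}$ and $x\in\mathbb{R}^n$, for some degree $d>0$. *)

(* Defs.v *)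
From HB Require Import structures.
From mathcomp Require Import all_boot all_order all_algebra.
From mathcomp Require Import all_classical all_reals all_analysis.
Set Implicit Arguments.
Unset Strict Implicit.
Unset Printing Implicit Defensive.
Import Order.TTheory GRing.Theory Num.Theory.
Import numFieldNormedType.Exports.
Local Open Scope classical_set_scope.
Local Open Scope ring_scope.

(* A word B_k ... B_1, read from right to left, is stored in reading order,
   i.e., as the sequence [:: B_1; ...; B_k]; so the product of the word is
   B_k *m ... *m B_1. *)
Definition word_mx (R : pzRingType) (n : nat) (w : seq 'M[R]_n) : 'M[R]_n :=
  foldl (fun P B => B *m P) 1%:M w.

(* `|_| is the entrywise maximum norm. *)
Definition max_word_norm (R : realType) (m n : nat) (A : 'I_m -> 'M[R]_n)
    (k : nat) : R :=
  \big[Num.max/0]_(s : k.-tuple 'I_m) `|word_mx [seq A i | i <- s]|.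

Lemma word_mx_cat (R : pzRingType) (n : nat) (v w : seq 'M[R]_n) :
  word_mx (v ++ w) = word_mx w *m word_mx v.
Proof.
rewrite /word_mx foldl_cat; move: (foldl _ _ v) => P.
elim/last_ind: w => [|w B IHw]; first by rewrite mul1mx.
by rewrite !foldl_rcons IHw mulmxA.
Qed.

Lemma mx_norm_mulmx (R : realType) (n : nat) (A B : 'M[R]_n) :
  `|A *m B| <= n%:R * (`|A| * `|B|).
Proof.
have le_norm (M : 'M[R]_n) i j : `|M i j| <= `|M|.
  by rewrite [`|M|]mx_normrE (le_bigmax 0 (fun ij => `|M ij.1 ij.2|) (i, j)).
rewrite [`|A *m B|]mx_normrE; apply: bigmax_le => [|[i j] _ /=].
  by rewrite !mulr_ge0.
rewrite mxE (le_trans (ler_norm_sum _ _ _))//.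
rewrite -[n in n%:R]card_ord mulr_natl -sumr_const ler_sum// => l _.
by rewrite normrM ler_pM.
Qed.

Lemma max_word_norm_ge0 (R : realType) (m n : nat) (A : 'I_m -> 'M[R]_n)
  (k : nat) : 0 <= max_word_norm A k.
Proof. exact: bigmax_ge_id. Qed.

Lemma max_word_normD (R : realType) (m n : nat) (A : 'I_m -> 'M[R]_n)
    (j k : nat) :
  max_word_norm A (j + k) <= n%:R * (max_word_norm A j * max_word_norm A k).
Proof.
apply: bigmax_le => [|s _]; first by rewrite !mulr_ge0// max_word_norm_ge0.
have sz_l : size (take j s) == j by 
  by rewrite size_take_min size_tuple; apply/eqP/minn_idPl/leq_addr.
have sz_r : size (drop j s) == k by rewrite size_drop size_tuple addKn.
rewrite -[tval s](cat_take_drop j) map_cat word_mx_cat.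
rewrite (le_trans (mx_norm_mulmx _ _))// mulrC [leRHS]mulrC ler_wpM2r//.
rewrite [leRHS]mulrC ler_pM//.
  exact: (le_bigmax 0 (fun t : k.-tuple 'I_m => `|word_mx [seq A i | i <- t]|) (Tuple sz_r)).
exact: (le_bigmax 0 (fun t : j.-tuple 'I_m => `|word_mx [seq A i | i <- t]|) (Tuple sz_l)).
Qed.

Lemma cvg_powR_inv_nat (R : realType) (C : R) :
  0 < C -> C `^ (k%:R^-1) @[k --> \oo] --> (1 : R).
Proof.
move=> C0.
have cvg_inv : (k%:R^-1 : R) @[k --> \oo] --> (0 : R).
  by rewrite -cvg_shiftS; exact: cvg_harmonic.
have : expR (k%:R^-1 * ln C) @[k --> \oo] --> expR (0 * ln C).
  apply: continuous_cvg; [exact: continuous_expR | exact: (cvgMr_tmp cvg_inv)].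
rewrite mul0r expR0 (_ : (fun k : nat => expR _) = fun k => C `^ (k%:R^-1))//.
by apply/funext => k; rewrite /powR gt_eqF.
Qed.

Lemma fekete (R : realType) (u : nat -> R) :
  (forall k, 0 <= u k) -> (forall j k, u (j + k)%N <= u j * u k) ->
  cvgn (fun k : nat => u k `^ (k%:R^-1)).
Proof.
move=> u_ge0 uM; set v := fun k => _.
have v_ge0 k : 0 <= v k by exact: powR_ge0.
pose E := [set v k | k in [set k | (0 < k)%N]].
have E_lb : has_lbound E by exists 0 => _ [k _ <-].
have E_inf : has_inf E by split=> //; exists (v 1%N), 1%N.
apply/cvg_ex; exists (inf E); apply/cvgrPdist_le => e e0.
have e20 : 0 < e / 2 by rewrite divr_gt0.
have [_ [p p0 <-] lt_vp] := inf_adherent e20 E_inf.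
set r := inf E + e / 2 in lt_vp.
have r0 : 0 < r by exact: le_lt_trans lt_vp.
have le_up : u p <= r ^+ p.
  rewrite -[u p]powRr1// -[1](@mulVf _ p%:R) ?pnatr_eq0 -?lt0n//.
  rewrite powRrM powR_mulrn ?powR_ge0// lerXn2r ?nnegrE ?powR_ge0 ?ltW//.
pose C := 1 + \sum_(s < p) u s / r ^+ s.
have C0 : 0 < C.
  by rewrite ltr_pwDl// sumr_ge0// => s _; rewrite divr_ge0// exprn_ge0// ltW.
have le_u k : u k <= r ^+ k * C.
  elim/ltn_ind: k => k IHk; have [lt_kp|le_pk] := ltnP k p.
    rewrite mulrC -ler_pdivrMr ?exprn_gt0// /C (bigD1 (Ordinal lt_kp))//=.
    rewrite addrCA lerDl addr_ge0// sumr_ge0// => s _.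
    by rewrite divr_ge0// exprn_ge0// ltW.
  rewrite -(subnKC le_pk) (le_trans (uM _ _))// exprD -mulrA ler_pM//.
  by apply: IHk; rewrite ltn_subrL p0 (leq_trans p0).
have cvg_rC : r * C `^ (k%:R^-1) @[k --> \oo] --> r.
  by rewrite -[X in _ --> X]mulr1; apply: cvgMl_tmp; exact: cvg_powR_inv_nat.
near=> k.
have k0 : (0 < k)%N by near: k; exists 1%N.
have le_v : v k <= r * C `^ (k%:R^-1).
  have -> : r * C `^ (k%:R^-1) = (r ^+ k * C) `^ (k%:R^-1).
    rewrite powRM ?exprn_ge0 ?(ltW r0) ?(ltW C0)// -powR_mulrn ?(ltW r0)//.
    by rewrite -powRrM mulfV ?pnatr_eq0 -?lt0n// powRr1 ?(ltW r0).
  by apply: ge0_ler_powR; rewrite ?nnegrE ?mulr_ge0 ?exprn_ge0 ?(ltW r0) ?(ltW C0).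
have le_rC : r * C `^ (k%:R^-1) <= r + e / 2.
  have : `|r - r * C `^ (k%:R^-1)| <= e / 2.
    by near: k; move/cvgrPdist_le : cvg_rC; exact.
  by rewrite ler_distlC => /andP[].
have le_Lv : inf E <= v k by apply: ge_inf => //; exists k.
rewrite ler0_norm ?subr_le0// opprB lerBlDl (le_trans le_v)// (le_trans le_rC)//.
by rewrite /r -addrA -splitr.
Unshelve. all: by end_near.
Qed.

Lemma is_cvg_max_word_norm (R : realType) (m n : nat) (A : 'I_m -> 'M[R]_n) :
  cvgn (fun k : nat => max_word_norm A k `^ (k%:R^-1)).
Proof.
have c0 : 0 < n.+1%:R :> R by [].
pose u k := n.+1%:R * max_word_norm A k.
have cvg_u : cvgn (fun k : nat => u k `^ (k%:R^-1)).
  apply: fekete => [k|j k]; first by rewrite mulr_ge0// max_word_norm_ge0.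
  rewrite /u -mulrA ler_pM2l// mulrCA (le_trans (max_word_normD _ _ _))//.
  by rewrite ler_wpM2r ?ler_nat// mulr_ge0// max_word_norm_ge0.
have cvg_c : cvgn (fun k : nat => (n.+1%:R^-1 : R) `^ (k%:R^-1)).
  by apply/cvg_ex; exists 1; apply: cvg_powR_inv_nat; rewrite invr_gt0.
rewrite (_ : (fun k => _) = (fun k : nat => (n.+1%:R^-1 : R) `^ (k%:R^-1))
    \* (fun k : nat => u k `^ (k%:R^-1))); first exact: is_cvgM.
apply/funext => k; rewrite /u /= -powRM ?mulKf ?gt_eqF//.
by rewrite mulr_ge0// max_word_norm_ge0.
Qed.

(* By the previous lemma this is a genuine limit; it does not depend on the
   norm, and the term k = 0 of the sequence is irrelevant. *)
Definition jsr (R : realType) (m n : nat) (A : 'I_m -> 'M[R]_n) : R :=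
  limn (fun k : nat => max_word_norm A k `^ (k%:R^-1)).

Record word_graph (T : Type) := WordGraph {
  node : finType;
  edge : finType;
  src : edge -> node;
  tgt : edge -> node;
  label : edge -> seq T }.

Definition labeled_over (T : eqType) (m : nat) (B : 'I_m -> T)
    (G : word_graph T) : Prop :=
  forall e : edge G, label e != [::] /\ {subset label e <= codom B}.

Section Expanded.
Variables (T : Type) (G : word_graph T).

(* The second summand contains the size (label e) - 1 nodes added on edge e. *)
Definition exp_node : finType :=
  (node G + {e : edge G & 'I_(size (label e)).-1})%type.

Definition exp_edge : finType := {e : edge G & 'I_(size (label e))}.

(* k-th node on the path replacing e: src e for k = 0, the k-th added node for
   0 < k < size (label e), and tgt e for k = size (label e). *)
Definition exp_pos (e : edge G) (k : nat) : exp_node :=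
  if k is k'.+1 then
    if insub k' is Some s then
      inr (existT (fun f : edge G => 'I_(size (label f)).-1) e s)
    else inl (tgt e)
  else inl (src e).

Definition expanded_graph : word_graph T := {|
  node := exp_node;
  edge := exp_edge;
  src := fun f : exp_edge => exp_pos (tag f) (tagged f);
  tgt := fun f : exp_edge => exp_pos (tag f) (tagged f).+1;
  label := fun f : exp_edge =>
    [:: tnth (in_tuple (label (tag f))) (tagged f)] |}.

Definition directed_path (p : seq (edge G)) : bool :=
  sorted (fun e f => tgt e == src f) p.

End Expanded.

Definition path_complete (T : Type) (m : nat) (B : 'I_m -> T)
    (G : word_graph T) : Prop :=
  forall (k : nat) (s : k.-tuple 'I_m), (0 < k)%N ->
  exists p : seq (edge (expanded_graph G)),
    directed_path p /\
    [seq label f | f <- p] = [seq [:: B i] | i <- s].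

Definition graph_lyapunov (R : realType) (n : nat) (G : word_graph 'M[R]_n)
    (V : node G -> 'cV[R]_n -> R) : Prop :=
  forall (e : edge G) (x : 'cV[R]_n),
    V (tgt e) (word_mx (label e) *m x) <= V (src e) x.

Definition positive_fun (R : realType) (n : nat) (V : 'cV[R]_n -> R) : Prop :=
  forall x : 'cV[R]_n, x != 0 -> 0 < V x.

(* The power l ^ d for a real exponent d > 0 and an arbitrary real base l; the
   library's l `^ d is 1 for l < 0.  For l < 0 this is the usual power when d
   is an integer; for other d it is |l| ^ d, the only possible factor in
   V (l *: x) = l ^ d * V x for V positive. *)
Definition rpow (R : realType) (l d : R) : R :=
  if 0 <= l then l `^ d
  else if d \is a Num.nat then l ^+ Num.truncn d
  else `|l| `^ d.

Definition homogeneous_fun (R : realType) (n : nat) (V : 'cV[R]_n -> R) : Prop :=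
  exists2 d : R, 0 < d &
    forall (l : R) (x : 'cV[R]_n), V (l *: x) = rpow l d * V x.

(* Main.v *)
Require Import Defs.
From HB Require Import structures.
From mathcomp Require Import all_boot all_order all_algebra.
From mathcomp Require Import all_classical all_reals all_analysis.
Import Order.TTheory GRing.Theory Num.Theory.
Import numFieldNormedType.Exports.
Local Open Scope classical_set_scope.
Local Open Scope ring_scope.
Set Implicit Arguments.
Unset Strict Implicit.
Unset Printing Implicit Defensive.

(** A product of letters along a path of the graph itself, from node i to node
    j, is a matrix M with V_j (M x) <= V_i x for all x.  Evaluated at the unit
    vectors, this puts the columns of M in a sublevel set of V_j.  Sublevel
    sets of a positive, continuous and homogeneous function are bounded
    ([sublevel_bounded]), since the function is bounded below by a positive
    constant on the unit sphere.  As there are finitely many nodes, such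
    products are bounded by one constant, whatever their length; this holds
    even when the V_i have different degrees of homogeneity.

    A path of the expanded graph can also start and stop inside an edge of the
    original graph, so a product along it has in addition a factor given by a
    proper suffix of a label at the beginning and by a proper prefix of a label
    at the end.  A path that never leaves one edge reads an infix of
    its label.  There are finitely many such factors and infixes, so the bound
    only changes by a constant.  The invariant
    [node_inv], carried along the path, records at each node of the expanded
    graph how the product read so far splits ([node_inv_path]), and it implies a
    bound on the norm that does not depend on the path ([node_inv_bounded]).

    By path-completeness every product of matrices gamma A_i is read along such
    a path ([word_bounded]), so all of them are bounded by some K > 0.  Hence
    products of k matrices A_i have norm at most K / gamma ^ k, and the k-th
    root of this bound tends to 1 / gamma. *)

(** * Sublevel sets of positive homogeneous functions *)

Lemma ler_entry_norm (R : realType) (m n : nat) (M : 'M[R]_(m, n)) i j :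
  `|M i j| <= `|M|.
Proof.
rewrite [leRHS]mx_normrE.
exact: (le_bigmax 0 (fun ij => `|M ij.1 ij.2|) (i, j)).
Qed.

Lemma mx_norm_le (R : realType) (m n : nat) (M : 'M[R]_(m, n)) (r : R) :
  0 <= r -> (forall i j, `|M i j| <= r) -> `|M| <= r.
Proof.
by move=> r0 Mr; rewrite [leLHS]mx_normrE; apply: bigmax_le => // -[i j] _.
Qed.

Lemma mx_norm_col_le (R : realType) (m n : nat) (M : 'M[R]_(m, n)) (r : R) :
  0 <= r -> (forall j, `|col j M| <= r) -> `|M| <= r.
Proof.
move=> r0 Mr; apply: mx_norm_le => // i j; apply: le_trans (Mr j).
by have -> : M i j = col j M i 0; [rewrite mxE | exact: ler_entry_norm].
Qed.

Lemma mx_norm_trmx (R : realType) (m n : nat) (M : 'M[R]_(m, n)) :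
  `|M^T| = `|M|.
Proof.
apply/eqP; rewrite eq_le; apply/andP; split; apply: mx_norm_le => // i j.
  by rewrite mxE ler_entry_norm.
by apply: le_trans (ler_entry_norm M^T j i); rewrite mxE.
Qed.

Lemma trmx_continuous (R : realType) (m n : nat) :
  continuous (@trmx R m n).
Proof.
move=> M S /nbhs_ballP[e e0 eS]; apply/nbhs_ballP; exists e => // N [_ MN].
by apply: eS; split=> // i j; rewrite !mxE; exact: MN.
Qed.

(** Transposition is a continuous isometry, so it is enough to treat row
    vectors, for which closed bounded sets are compact. *)
Lemma sphere_compact (R : realType) (n : nat) :
  compact [set y : 'cV[R]_n | `|y| = 1].
Proof.
have row_sphere : compact [set y : 'rV[R]_n | `|y| = 1].
  apply: bounded_closed_compact.
    exists 1; split=> [|r r1 y /= ->]; [exact: num_real | exact: ltW].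
  apply: (@closed_comp _ _ _ [set x : R | x = 1]); last exact: closed_eq.
  by move=> y _; exact: norm_continuous.
rewrite (_ : mkset _ = trmx @` [set y : 'rV[R]_n | `|y| = 1]); last first.
  apply/seteqP; split=> [y /= y1|_ [y /= y1 <-]]; last by rewrite mx_norm_trmx.
  by exists y^T; rewrite ?trmxK//= mx_norm_trmx.
apply: continuous_compact row_sphere.
by apply: continuous_subspaceT; exact: trmx_continuous.
Qed.

(** On the unit sphere V is at least some a > 0, so V x >= a |x| ^ d. *)
Lemma sublevel_bounded (R : realType) (n : nat) (V : 'cV[R]_n -> R) (b : R) :
  positive_fun V -> continuous V -> homogeneous_fun V ->
  exists2 r, 0 <= r & forall x, V x <= b -> `|x| <= r.
Proof.
move=> Vpos Vcont [d d0 Vhom].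
have [a a0 Va] : exists2 a, 0 < a & forall y, `|y| = 1 -> a <= V y.
  have [[y y1]|sph0] := pselect ([set y : 'cV[R]_n | `|y| = 1] !=set0); last first.
    by exists 1 => // y y1; case: sph0; exists y.
  have Vsph : {within [set y : 'cV[R]_n | `|y| = 1], continuous V}.
    exact: continuous_subspaceT.
  have [z] := compact_EVT_min (ex_intro _ y y1) (@sphere_compact R n) Vsph.
  rewrite inE /= => z1 Vz.
  exists (V z) => [|x x1]; last by apply: Vz; rewrite inE.
  by apply: Vpos; rewrite -normr_eq0 z1 oner_eq0.
exists ((Num.max b 0 / a) `^ d^-1) => [|x Vxb]; first exact: powR_ge0.
have [->|x0] := eqVneq x 0; first by rewrite normr0 powR_ge0.
have nx0 : `|x| != 0 by rewrite normr_eq0.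
have Vx : `|x| `^ d * a <= V x.
  rewrite -[x in V x](scalerKV nx0) Vhom /rpow normr_ge0.
  rewrite ler_wpM2l ?powR_ge0//; apply: Va.
  by rewrite normrZ normfV normr_id mulVf.
rewrite -[`|x|]powRr1// -[1](mulfV (lt0r_neq0 d0)) powRrM.
apply: ge0_ler_powR.
- by rewrite invr_ge0 ltW.
- by rewrite nnegrE powR_ge0.
- by rewrite nnegrE divr_ge0 ?(ltW a0)// le_max lexx orbT.
- by rewrite ler_pdivlMr// (le_trans Vx)// (le_trans Vxb)// le_max lexx.
Qed.

(** * Words *)

Lemma word_mx_rcons (R : pzRingType) (n : nat) (w : seq 'M[R]_n) B :
  word_mx (rcons w B) = B *m word_mx w.
Proof. by rewrite /word_mx foldl_rcons. Qed.

Lemma word_mx_scale (R : comPzRingType) (n : nat) (I : Type)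
    (A : I -> 'M[R]_n) (c : R) (s : seq I) :
  word_mx [seq c *: A i | i <- s] = c ^+ size s *: word_mx [seq A i | i <- s].
Proof.
elim/last_ind: s => [|s i IHs]; first by rewrite scale1r.
rewrite !map_rcons !word_mx_rcons IHs size_rcons exprS.
by rewrite -scalemxAl -scalemxAr scalerA.
Qed.

(** * Products along paths of the expanded graph *)

Section PathProducts.
Variables (R : realType) (n : nat) (G : word_graph 'M[R]_n).
Variables (V : node G -> 'cV[R]_n -> R) (b : R).
Implicit Types (e : edge G) (M : 'M[R]_n) (i : node G) (k : nat).

Definition cols_sublevel i M := forall l, V i (col l M) <= b.

(** The two ways to have read a product M when k letters of the label of e
    have been passed: the path has entered e through its source, with a product
    already controlled there, or it has started inside e. *)
Definition edge_inv e k M :=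
  (exists2 M0, cols_sublevel (src e) M0 & M = word_mx (take k (label e)) *m M0)
  \/ (exists2 j, (j <= k)%N & M = word_mx (drop j (take k (label e)))).

Definition node_inv (q : exp_node G) M :=
  match q with
  | inl i => cols_sublevel i M
  | inr s => edge_inv (tag s) (tagged s).+1 M
  end.

Hypothesis V_lyap : graph_lyapunov V.
(* A path starting inside e reaches the target of e with a suffix of its label;
   the empty suffix takes care of paths starting at a node of G. *)
Hypothesis V_suffix : forall i e j, cols_sublevel i (word_mx (drop j (label e))).

Lemma node_inv_edge_inv e k M : (k < size (label e))%N ->
  node_inv (exp_pos e k) M -> edge_inv e k M.
Proof.
case: k => [_ /= iM|k lt_k /=].
  by left; exists M; rewrite // take0 mul1mx.
by case: insubP => [s _ <-|] //; rewrite ltn_predRL lt_k.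
Qed.

Lemma edge_inv_node_inv e k M : (k < size (label e))%N ->
  edge_inv e k.+1 M -> node_inv (exp_pos e k.+1) M.
Proof.
move=> lt_k /=; case: insubP => [s _ <-//|].
rewrite ltn_predRL -leqNgt => le_k /=.
rewrite /edge_inv take_oversize// => -[[M0 iM0 ->] l|[j _ ->]].
  by rewrite colE -mulmxA -colE (le_trans (V_lyap _ _)).
exact: V_suffix.
Qed.

Lemma edge_inv_step e M (s : 'I_(size (label e))) :
  edge_inv e s M -> edge_inv e s.+1 (tnth (in_tuple (label e)) s *m M).
Proof.
rewrite (tnth_nth 0) /= => -[[M0 iM0 ->]|[j le_j ->]].
  by left; exists M0; rewrite // (take_nth 0)// word_mx_rcons mulmxA.
right; exists j; first exact: leqW.
rewrite (take_nth 0)// drop_rcons ?word_mx_rcons//.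
by rewrite size_take ltn_ord.
Qed.

Lemma node_inv_start (f : edge (expanded_graph G)) : node_inv (src f) 1%:M.
Proof.
case: f => e [k lt_k] /=.
case: k lt_k => [|k] lt_k.
  by have := V_suffix (src e) e (size (label e)); rewrite drop_size.
apply: edge_inv_node_inv; first exact: ltnW.
by right; exists k.+1; rewrite // drop_oversize// size_take lt_k.
Qed.

Lemma node_inv_edge (f : edge (expanded_graph G)) M :
  node_inv (src f) M -> node_inv (tgt f) (word_mx (label f) *m M).
Proof.
case: f => e s /= /(node_inv_edge_inv (ltn_ord s))/edge_inv_step.
rewrite /word_mx /= mulmx1; exact: edge_inv_node_inv.
Qed.

Lemma node_inv_path (f : edge (expanded_graph G)) p :
  directed_path (f :: p) ->
  node_inv (tgt (last f p)) (word_mx (flatten [seq label g | g <- f :: p])).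
Proof.
elim/last_ind: p => [_|p g IHp].
  by have := node_inv_edge (node_inv_start f); rewrite mulmx1.
rewrite [directed_path _]rcons_path => /andP[/IHp fp /eqP fg].
rewrite last_rcons -rcons_cons map_rcons flatten_rcons word_mx_cat.
by apply: node_inv_edge; rewrite -fg.
Qed.

Hypothesis V_good : forall i,
  [/\ positive_fun (V i), continuous (V i) & homogeneous_fun (V i)].

Lemma node_inv_bounded : exists K, forall q M, node_inv q M -> `|M| <= K.
Proof.
have [r Vr] : exists r, forall i M, cols_sublevel i M -> `|M| <= r.
  have /choice[r Vr] i : exists r, 0 <= r /\ forall x, V i x <= b -> `|x| <= r.
    have [Vp Vc Vh] := V_good i.
    by have [r r0 Vr] := sublevel_bounded b Vp Vc Vh; exists r.
  exists (\big[Num.max/0]_i r i) => i M iM.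
  apply: le_trans (le_bigmax 0 r i); have [r0 {}Vr] := Vr i.
  by apply: mx_norm_col_le => // l; exact: Vr.
pose D e : R := \sum_(j < (size (label e)).+1) \sum_(k < (size (label e)).+1)
  `|word_mx (drop j (take k (label e)))|.
pose C : R := \big[Num.max/0]_e D e.
have le_C e j k : (j <= size (label e))%N -> (k <= size (label e))%N ->
    `|word_mx (drop j (take k (label e)))| <= C.
  rewrite -ltnS => lt_j; rewrite -ltnS => lt_k.
  apply: le_trans (le_bigmax 0 D e); rewrite /D.
  rewrite (bigD1 (Ordinal lt_j))//= (bigD1 (Ordinal lt_k))//= -addrA lerDl.
  by rewrite addr_ge0// sumr_ge0// => k' _; rewrite sumr_ge0.
have C0 : 0 <= C by exact: bigmax_ge_id.
exists (`|r| + n%:R * (C * `|r|) + C) => -[i M iM|[e [k lt_k]] M /= eM].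
  rewrite -addrA (le_trans (Vr _ _ iM))// (le_trans (ler_norm r))// lerDl.
  by rewrite addr_ge0// !mulr_ge0.
have {}lt_k : (k < size (label e))%N by move: lt_k; rewrite ltn_predRL => /ltnW.
case: eM => [[M0 iM0 ->]|[j le_j ->]]; last first.
  rewrite (le_trans (le_C e j k.+1 _ _))// ?(leq_trans le_j)// lerDr.
  by rewrite addr_ge0// !mulr_ge0.
rewrite (le_trans (mx_norm_mulmx _ _))// -addrA addrCA -[leLHS]addr0.
rewrite lerD ?addr_ge0// ler_wpM2l// ler_pM//.
  by have := le_C e 0%N k.+1 (leq0n _) lt_k; rewrite drop0.
exact: le_trans (Vr _ _ iM0) (ler_norm r).
Qed.

End PathProducts.

(** The constant b is the maximum of finitely many values, chosen so that every
    suffix of a label has its columns in all the sublevel sets; it does not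
    depend on the word. *)
Lemma word_bounded (R : realType) (m n : nat) (B : 'I_m -> 'M[R]_n)
    (G : word_graph 'M[R]_n) (V : node G -> 'cV[R]_n -> R) :
  path_complete B G ->
  (forall i, [/\ positive_fun (V i), continuous (V i) & homogeneous_fun (V i)]) ->
  graph_lyapunov V ->
  exists2 K, 0 < K & forall s : seq 'I_m, (0 < size s)%N ->
    `|word_mx [seq B i | i <- s]| <= K.
Proof.
move=> Gcomp V_good V_lyap.
pose v i (e : edge G) l j := V i (col l (word_mx (drop j (label e)))).
pose v_max (t : node G * edge G * 'I_n) :=
  \big[Num.max/0]_(j < (size (label t.1.2)).+1) v t.1.1 t.1.2 t.2 j.
pose b := \big[Num.max/0]_t v_max t.
have V_suffix i (e : edge G) j : cols_sublevel V b i (word_mx (drop j (label e))).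
  move=> l; wlog le_j : j / (j <= size (label e))%N.
    move=> H; case: (leqP j (size (label e))) => [|/ltnW] le_j; first exact: H.
    by rewrite drop_oversize//; have := H _ (leqnn _); rewrite drop_size.
  rewrite -ltnS in le_j; apply: le_trans (le_bigmax 0 v_max (i, e, l)).
  exact: (le_bigmax 0 (fun j' : 'I__ => v i e l j') (Ordinal le_j)).
have [K le_K] := node_inv_bounded b V_good.
exists (`|K| + 1) => [|s s_gt0]; first by rewrite ltr_wpDl.
have [p [p_path p_label]] := Gcomp _ (in_tuple s) s_gt0.
case: p => [|f p] in p_path p_label.
  by case: s s_gt0 p_label.
have := node_inv_path V_lyap V_suffix p_path.
rewrite p_label (_ : flatten _ = [seq B i | i <- s]); last first.
  by rewrite /= flatten_map1.
by move/le_K/le_trans; apply; rewrite (le_trans (ler_norm K))// lerDl.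
Qed.

(** * The joint spectral radius *)

Lemma jsr_le (R : realType) (m n : nat) (A : 'I_m -> 'M[R]_n) (c K : R) :
  0 <= c -> 0 < K ->
  (forall k, (0 < k)%N -> max_word_norm A k <= K * c ^+ k) -> jsr A <= c.
Proof.
move=> c0 K0 AK.
have cvg_Kc : K `^ (k%:R^-1) * c @[k --> \oo] --> c.
  by rewrite -[X in _ --> X]mul1r; apply: cvgMr_tmp; exact: cvg_powR_inv_nat.
rewrite /jsr -(cvg_lim _ cvg_Kc)//.
apply: ler_lim; [exact: is_cvg_max_word_norm | by apply/cvg_ex; exists c |].
near=> k.
have k0 : (0 < k)%N by near: k; exists 1%N.
have -> : K `^ (k%:R^-1) * c = (K * c ^+ k) `^ (k%:R^-1).
  rewrite powRM ?exprn_ge0 ?(ltW K0)// -powR_mulrn// -powRrM.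
  by rewrite mulfV ?pnatr_eq0 -?lt0n// powRr1.
apply: ge0_ler_powR; rewrite ?nnegrE ?max_word_norm_ge0//; last exact: AK.
by rewrite mulr_ge0 ?exprn_ge0// ltW.
Unshelve. all: by end_near.
Qed.

Unset Implicit Arguments.

Theorem theorem5p4 (R : realType) (m n : nat) (A : 'I_m -> 'M[R]_n) (gamma : R)
    (G : word_graph 'M[R]_n) :
  0 < gamma ->
  labeled_over (fun i : 'I_m => gamma *: A i) G ->
  path_complete (fun i : 'I_m => gamma *: A i) G ->
  (exists V : node G -> 'cV[R]_n -> R,
     (forall i : node G,
        [/\ positive_fun (V i), continuous (V i) & homogeneous_fun (V i)]) /\
     graph_lyapunov V) ->
  jsr A <= 1 / gamma.
Proof.
move=> gamma0 _ Gcomp [V [V_good V_lyap]].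
have [K K0 le_K] := word_bounded Gcomp V_good V_lyap.
rewrite div1r; apply: (@jsr_le _ _ _ _ _ K) => // [|k k0].
  by rewrite invr_ge0 ltW.
apply: bigmax_le => [|s _].
  by rewrite mulr_ge0 ?exprn_ge0 ?invr_ge0 ?(ltW gamma0) ?(ltW K0).
rewrite exprVn ler_pdivlMr ?exprn_gt0// mulrC.
have := le_K s; rewrite size_tuple => /(_ k0).
by rewrite word_mx_scale size_tuple normrZ gtr0_norm ?exprn_gt0.
Qed.
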